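(* Let $C$ be a nonempty closed convex subset of $X$, let $F\colon X\to Y\cup\{+\infty_Y\}$ be a proper $K$-convex mapping such that $y^*\circ F$ is lower semicontinuous for all $y^*\in Y^*$, and let $G\colon X\to Z\cup\{+\infty_Z\}$ be a proper $S$-convex and $S$-epi closed mapping. Let $A:=C\cap G^{-1}(-S)$ and let $\bar x\in A\cap\operatorname{dom}F$. Then the following statements are equivalent: $(e)$ The set $\bigcup_{T\in\mathcal{L}_+(S,K)}\operatorname{epi}_K(F+I_C+T\circ G)^*$ is closed regarding $\{(0_{\mathcal{L}},-F(\bar x))\}$. $(f)$ $\bar x$ is a weak solution of $(\mathrm{VOP})$ if and only if there exists $T\in\mathcal{L}_+(S,K)$ such that $$-F(\bar x)\in(F+I_C+T\circ G)^*(0_{\mathcal{L}})+K.$$ $(g)$ $\bar x$ is a weak solution of $(\mathrm{VOP})$ if and only if there exists $T\in\mathcal{L}_+(S,K)$ such that $$F(x)+(T\circ G)(x)-F(\bar x)\notin-\operatorname{int}K,\quad\forall x\in C.$$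
   Context: $X,Y,Z$ are (real) locally convex Hausdorff topological vector spaces with topological duals $X^*,Y^*,Z^*$; $K\subset Y$ is a closed, pointed, convex cone with $\operatorname{int}K\neq\emptyset$; $S\subset Z$ is a nonempty closed convex cone. Order and infinite elements: for $y_1,y_2\in Y$, $y_1<_K y_2$ means $y_1-y_2\in-\operatorname{int}K$. $Y^\bullet:=Y\cup\{-\infty_Y,+\infty_Y\}$, where $\pm\infty_Y\notin Y$ and $-\infty_Y<_K y<_K+\infty_Y$ for all $y\in Y$ (hence also $-\infty_Y<_K+\infty_Y$). Conventions: $-(+\infty_Y)=-\infty_Y$, $-(-\infty_Y)=+\infty_Y$, $(+\infty_Y)+y=y+(+\infty_Y)=+\infty_Y$ for $y\in Y\cup\{+\infty_Y\}$, $(-\infty_Y)+y=y+(-\infty_Y)=-\infty_Y$ for $y\in Y\cup\{-\infty_Y\}$. Analogous elements $\pm\infty_Z$ and conventions are used for $Z$ (ordered by $S$). Weak supremum/infimum: for $\emptyset\neq M\subset Y^\bullet$, $\operatorname{WSup}M$ is the set of $\bar v\in Y^\bullet$ such that $\bar v\not<_K v$ for all $v\in M$, and for every $\tilde v\in Y^\bullet$ with $\tilde v<_K\bar v$ there is $v\in M$ with $\tilde v<_K v$. $\operatorname{WInf}M$ is the set of $\bar v\in Y^\bullet$ such that $v\not<_K\bar v$ for all $v\in M$, and for every $\tilde v\in Y^\bullet$ with $\bar v<_K\tilde v$ there is $v\in M$ with $v<_K\tilde v$. $\operatorname{WMin}M=M\cap\operatorname{WInf}M$. $(\mathrm{VOP})$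 is the problem $\operatorname{WMin}\{F(x): x\in C,\ G(x)\in-S\}$, and $\bar x\in A$ is a weak solution of $(\mathrm{VOP})$ if $F(\bar x)\in\operatorname{WMin}F(A)$. Mappings: for $F\colon X\to Y^\bullet$, $\operatorname{dom}F=\{x\in X: F(x)\neq+\infty_Y\}$; $F$ is proper if $\operatorname{dom}F\neq\emptyset$ and $-\infty_Y\notin F(X)$; $\operatorname{epi}_KF=\{(x,y)\in X\times Y: y\in F(x)+K\}$; $F$ is $K$-convex if $\operatorname{epi}_KF$ is convex, and $K$-epi closed if it is closed. The same notions are used for $G$ with $(Z,S)$ in place of $(Y,K)$. For $y^*\in Y^*$, $(y^*\circ F)(x)=y^*(F(x))$ if $F(x)\in Y$ and $+\infty$ if $F(x)=+\infty_Y$. $\mathcal{L}(X,Y)$ is the space of continuous linear mappings $X\to Y$ with the topology of pointwise convergence; $0_{\mathcal{L}}$ is its zero element. The conjugate of $F$ is the set-valued map $F^*(L)=\operatorname{WSup}\{L(x)-F(x):x\in X\}$, $L\in\mathcal{L}(X,Y)$, and $\operatorname{epi}_KF^*=\{(L,y)\in\mathcal{L}(X,Y)\times Y: y\in F^*(L)+K\}$. For $D\subset X$, $I_D(x)=0_Y$ if $x\in D$ and $I_D(x)=+\infty_Y$ otherwise. For $T\in\mathcal{L}(Z,Y)$, $(T\circ G)(x)=T(G(x))$ if $G(x)\in Z$ and $+\infty_Y$ if $G(x)=+\infty_Z$. $\mathcal{L}_+(S,K)=\{T\in\mathcal{L}(Z,Y): T(S)\subset K\}$. For subsets $P,Q$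 of a topological space (here $\mathcal{L}(X,Y)\times Y$), $P$ is closed regarding $Q$ if $Q\cap\operatorname{cl}P=Q\cap P$. *)

(* Defs.v *)
From HB Require Import structures.
From mathcomp Require Import all_boot all_order all_algebra.
From mathcomp Require Import all_classical all_reals all_analysis.

Set Implicit Arguments.
Unset Strict Implicit.
Unset Printing Implicit Defensive.

Import Order.TTheory GRing.Theory Num.Theory.
Import numFieldNormedType.Exports.

Local Open Scope classical_set_scope.
Local Open Scope ring_scope.

Record contLinear (R : realType) (X Y : tvsType R) := ContLinear {
  contLinear_fun :> {linear X -> Y};
  contLinear_cont : continuous contLinear_fun
}.

HB.instance Definition _ (R : realType) (X Y : tvsType R) :=
  gen_eqMixin (contLinear X Y).
HB.instance Definition _ (R : realType) (X Y : tvsType R) :=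
  gen_choiceMixin (contLinear X Y).
HB.instance Definition _ (R : realType) (X Y : tvsType R) :=
  Topological.copy (contLinear X Y)
    (initial_topology (fun L : contLinear X Y => (L : {ptws X -> Y}))).

Lemma contLinear0_cont (R : realType) (X Y : tvsType R) :
  continuous (\0 : {linear X -> Y}).
Proof. by move=> x; exact: cvg_cst. Qed.

Definition contLinear0 (R : realType) (X Y : tvsType R) : contLinear X Y :=
  ContLinear (@contLinear0_cont R X Y).

Definition top_dual (R : realType) (Y : tvsType R) := contLinear Y R^o.

Definition oppset (V : zmodType) (A : set V) : set V := [set - a | a in A].

Definition is_cone (R : realType) (V : lmodType R) (K : set V) :=
  forall (t : R) (k : V), 0 <= t -> K k -> K (t *: k).

Definition pointed_cone (V : zmodType) (K : set V) :=
  K `&` oppset K = [set 0].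

(** The set Y with two infinite elements is [\bar Y]. The library sets
    [+oo + -oo = -oo]; the paper leaves this sum undefined, and it never occurs
    for mappings with values in Y and +oo. *)

Definition ltK (R : realType) (Y : tvsType R) (K : set Y) (u v : \bar Y) : Prop :=
  match u, v with
  | EFin y1, EFin y2 => oppset K° (y1 - y2)
  | ENInf, EFin _ | ENInf, EPInf | EFin _, EPInf => True
  | _, _ => False
  end.

Definition WSup (R : realType) (Y : tvsType R) (K : set Y) (M : set (\bar Y)) :
    set (\bar Y) :=
  [set vbar | (forall v, M v -> ~ ltK K vbar v) /\
    (forall w, ltK K w vbar -> exists2 v, M v & ltK K w v)].

Definition WInf (R : realType) (Y : tvsType R) (K : set Y) (M : set (\bar Y)) :
    set (\bar Y) :=
  [set vbar | (forall v, M v -> ~ ltK K v vbar) /\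
    (forall w, ltK K vbar w -> exists2 v, M v & ltK K v w)].

Definition WMin (R : realType) (Y : tvsType R) (K : set Y) (M : set (\bar Y)) :
    set (\bar Y) :=
  M `&` WInf K M.

Definition addset (Y : zmodType) (M : set (\bar Y)) (K : set Y) : set (\bar Y) :=
  [set (v + k%:E)%E | v in M & k in K].

Definition dom_ext (X : Type) (Y : Type) (F : X -> \bar Y) : set X :=
  [set x | F x <> +oo%E].

Definition proper_mapping (X : Type) (Y : Type) (F : X -> \bar Y) :=
  dom_ext F !=set0 /\ ~ range F -oo%E.

Definition epiK (X : Type) (Y : zmodType) (K : set Y) (F : X -> \bar Y) :
    set (X * Y) :=
  [set p | addset [set F p.1] K p.2%:E].

Definition K_convex (R : realType) (X Y : tvsType R) (K : set Y)
    (F : X -> \bar Y) :=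
  convex_set (epiK K F).

Definition K_epi_closed (R : realType) (X Y : tvsType R) (K : set Y)
    (F : X -> \bar Y) :=
  closed (epiK K F).

Definition conj_map (R : realType) (X Y : tvsType R) (K : set Y)
    (F : X -> \bar Y) (L : contLinear X Y) : set (\bar Y) :=
  WSup K (range (fun x => (L x)%:E - F x)%E).

Definition epiK_conj (R : realType) (X Y : tvsType R) (K : set Y)
    (F : X -> \bar Y) : set (contLinear X Y * Y) :=
  [set p | addset (conj_map K F p.1) K p.2%:E].

Definition indic_ext (X : Type) (Y : zmodType) (D : set X) (x : X) : \bar Y :=
  if `[< D x >] then 0%E else +oo%E.

(** The mapping F + I_C + T o G; [er_map T] sends +oo to +oo, which is the
    convention for T o G. *)
Definition lagrangian (R : realType) (X Y Z : tvsType R) (C : set X)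
    (F : X -> \bar Y) (G : X -> \bar Z) (T : contLinear Z Y) (x : X) : \bar Y :=
  (F x + indic_ext Y C x + er_map T (G x))%E.

Definition Lplus (R : realType) (Z Y : tvsType R) (S : set Z) (K : set Y) :
    set (contLinear Z Y) :=
  [set T | T @` S `<=` K].

Definition closed_regarding (T : topologicalType) (P Q : set T) :=
  Q `&` closure P = Q `&` P.

Definition feasible_set (R : realType) (X Z : tvsType R) (C : set X) (S : set Z)
    (G : X -> \bar Z) : set X :=
  C `&` G @^-1` (EFin @` oppset S).

Definition weak_solution (R : realType) (X Y Z : tvsType R) (K : set Y)
    (S : set Z) (C : set X) (F : X -> \bar Y) (G : X -> \bar Z) (xbar : X) :=
  feasible_set C S G xbar /\ WMin K (F @` feasible_set C S G) (F xbar).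

(* Main.v *)
Require Import Defs.
From HB Require Import structures.
From mathcomp Require Import all_boot all_order all_algebra.
From mathcomp Require Import all_classical all_reals all_analysis.
From mathcomp Require Import ring lra.
Import Order.TTheory GRing.Theory Num.Theory.
Import numFieldNormedType.Exports.
Local Open Scope classical_set_scope.
Local Open Scope ring_scope.

Set Implicit Arguments.
Unset Strict Implicit.
Unset Printing Implicit Defensive.

(** Write [yb] for the value of [F] at [xbar] and [P] for the union of the
epigraphs in [e].

If [M] contains a finite value, a point [y] lies in [WSup K M + K] exactly when
no element of [M] is strictly above [y] ([addset_WSupP]: slide [y] down along
an interior direction of [K] until it is about to fall strictly below a member
of [M]).  Applied to the opposites of the values of the Lagrangian, this turns
the right-hand side of [f], which says that [(0, - yb)] belongs to [P], into
the right-hand side of [g].  Hence all three statements follow from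

  [xbar] is a weak solution  <->  [(0, - yb)] lies in the closure of [P],

because [e] says that the closure may be replaced by [P] itself, and because
the existence of a multiplier always implies weak optimality.

From the closure to weak optimality: a feasible [x] with [F x] strictly below
[yb] would give an open condition [L x - F x - y \in int K] that holds at
[(0, - yb)] but at no point of [P], as [- T (G x)] belongs to [K].

From weak optimality to the closure: separating [0] from the open convex set
of all [F x - yb + k], with [x] feasible and [k] interior to [K], gives a
functional [ys] that is positive on [int K] and for which [xbar] minimizes the
convex lower semicontinuous function [ys \o F] on the feasible set
([scalarization]).  For such a scalar problem there are approximate Lagrange
multipliers, with an error functional that is small at finitely many given
points ([approximate_multiplier]).  Multiplying the scalar data by a vector
[e1] of [K] with [ys e1 = 1] gives points of [P] in every neighbourhood of
[(0, - yb)], since a neighbourhood of [0] for pointwise convergence only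
controls finitely many values ([nbhs_contLinear0]).

Approximate multipliers come from separating one point from one closed convex
set.  Let [E] be the closed convex set of all [(x, z, r)] with [x] in [C], [z]
in [G x + S] and [r] above the value at [x], and let [B] be a compact convex set
containing the given points and their opposites.  Optimality says that
[(xbar, 0, m - e)], with [m] the optimal value and [e > 0], is not in
[E + B * {0} * {0}], which is closed; the part in [x] of a separating
functional is then small on [B], relative to its coefficient on [r].

The separation theorem itself ([separation_open0]) is proved by choosing a
maximal convex cone [M] that contains the open convex set and avoids its
opposite.  Maximality makes [M] comparable with every vector up to sign, and
[x |-> sup {t | x - t u \in M}] is the functional. *)

(** * Convex sets and affine maps *)

(** The library states convexity through an abstract barycenter indexed by the
unit interval; this is the same notion in vector-space operations. *)
Lemma convex_setP (R : realType) (V : lmodType R) (A : set V) :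
  convex_set A <-> forall (t : R) x y, 0 < t -> t < 1 -> A x -> A y ->
    A (t *: x + (1 - t) *: y).
Proof.
rewrite convex_setW; split=> cA.
  move=> t x y t0 t1 Ax Ay.
  have t01 : (0 <= t <= 1)%R by rewrite !ltW.
  have := cA x y (mem_set Ax) (mem_set Ay) (Itv01 (ltW t0) (ltW t1)).
  by rewrite /= t0 t1 => /(_ isT isT)/set_mem.
move=> x y /set_mem Ax /set_mem Ay k k0 k1; apply/mem_set.
exact: cA.
Qed.

Lemma exists_contLinear (R : realType) (V W : tvsType R) (f : V -> W) :
  linear f -> continuous f -> exists L : contLinear V W, forall x, L x = f x.
Proof.
move=> flin fcont; pose Lf := GRing.isLinear.Build R V W _ f flin.
pose fl : {linear V -> W} := HB.pack f Lf.
by exists (@ContLinear R V W fl fcont).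
Qed.

Lemma scale_convB (R : realType) (V : lmodType R) (t : R) (a b c d : V) :
  t *: (a - b) + (1 - t) *: (c - d) =
  (t *: a + (1 - t) *: c) - (t *: b + (1 - t) *: d).
Proof. by rewrite !scalerBr addrACA opprD. Qed.

Section Continuity.
Context {R : realType} {E : tvsType R}.

Lemma continuous_affine_line (x v : E) : continuous (fun t : R => x + t *: v).
Proof.
move=> t.
apply: (@continuous_comp _ _ _ (fun t : R => (x, t *: v))
  (fun z : E * E => z.1 + z.2)); last exact: add_continuous.
apply: cvg_pair => /=; first exact: cvg_cst.
apply: (@continuous_comp _ _ _ (fun t : R => (t : R^o, v))
  (fun z : R^o * E => z.1 *: z.2)); last exact: scale_continuous.
apply: (@cvg_pair _ _ _ _ (nbhs (t : R^o))) => /=; first exact: cvg_id.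
exact: cvg_cst.
Qed.

Lemma continuous_affine (x a : E) (k : R) :
  continuous (fun y : E => x + k *: (y + a)).
Proof.
move=> t.
apply: (@continuous_comp _ _ _ (fun y : E => (x, k *: (y + a)))
  (fun z : E * E => z.1 + z.2)); last exact: add_continuous.
apply: cvg_pair => /=; first exact: cvg_cst.
apply: (@continuous_comp _ _ _ (fun y : E => (k : R^o, y + a))
  (fun z : R^o * E => z.1 *: z.2)); last exact: scale_continuous.
apply: (@cvg_pair _ _ _ _ (nbhs (k : R^o))) => /=; first exact: cvg_cst.
apply: (@continuous_comp _ _ _ (fun y : E => (y, a))
  (fun z : E * E => z.1 + z.2)); last exact: add_continuous.
by apply: cvg_pair => /=; [exact: cvg_id|exact: cvg_cst].
Qed.

(** An open set absorbs every direction from each of its points; this is where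
the topology enters the order arguments below. *)
Lemma open_absorbing (U : set E) (u x : E) : open U -> U u ->
  exists2 e : R, 0 < e & forall t : R, `|t| <= e -> U (u + t *: x).
Proof.
move=> oU Uu.
have : nbhs (u + (0 : R) *: x) U.
  by rewrite scale0r addr0; exact: open_nbhs_nbhs.
move=> /(@continuous_affine_line u x 0) /nbhs_ballP[e /= e0 eU].
exists (e / 2); first by rewrite divr_gt0.
move=> t te; apply: eU; rewrite /ball/= sub0r normrN.
by rewrite (le_lt_trans te)// ltr_pdivrMr// ltr_pMr// ltr1n.
Qed.

End Continuity.

(** * Separation of convex sets *)

(** Zorn's lemma among the convex cones disjoint from [- U].  A maximal such
cone [M] contains every [x] whose ray can be added to [M] without meeting
[- U]; the rays through points of [U] can be added by convexity, and if the
ray of [x] cannot then [- x] is a positive multiple of a sum of an element of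
[M] and an element of [U]. *)
Lemma maximal_cone (R : realType) (V : lmodType R) (U : set V) :
  convex_set U -> ~ U 0 -> exists M : set V,
    [/\ forall x y, M x -> M y -> M (x + y), is_cone M, U `<=` M,
        forall x, M x -> ~ U (- x) & forall x, M x \/ M (- x)].
Proof.
move=> /convex_setP cU U0.
pose P (A : set V) := [/\ forall x y, A x -> A y -> A (x + y), is_cone A &
  forall x, A x -> ~ U (- x)].
have [F FP Ftot|M [[MD MZ MU] Mmax]] := @Zorn_bigcup _ P.
  split.
  - move=> x y [A FA Ax] [B FB By].
    have [AB|BA] := Ftot _ _ FA FB.
      by exists B => //; have [+ _ _] := FP _ FB; apply => //; exact: AB.
    by exists A => //; have [+ _ _] := FP _ FA; apply => //; exact: BA.
  - by move=> t x t0 [A FA Ax]; exists A => //; have [_ + _] := FP _ FA; apply.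
  - by move=> x [A FA Ax]; have [_ _] := FP _ FA; apply.
(* The chain in Zorn's lemma may be empty, so [M] is only known to be nonempty
   by comparison with the zero cone. *)
have M0 : M 0.
  apply: contrapT => nM0; apply: (Mmax [set 0]); first split.
  - by move=> x Mx; exfalso; apply: nM0; rewrite -(scale0r x); exact: MZ.
  - by move=> /(_ 0 erefl).
  - split => [x y -> ->|t x _ ->|x ->]; rewrite /= ?addr0 ?scaler0//.
    by rewrite oppr0.
have Mray x : (forall m s, M m -> 0 <= s -> ~ U (- (m + s *: x))) -> M x.
  move=> xU; apply: contrapT => nMx.
  apply: (Mmax [set y | exists m s, [/\ M m, 0 <= s & y = m + s *: x]]).
    split=> [y My|/(_ x)].
      by exists y, 0; split => //; rewrite scale0r addr0.
    apply: contra_not nMx => /(_ _); apply; exists 0, 1.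
    by split => //; rewrite scale1r add0r.
  split.
  - move=> _ _ [m [s [Mm s0 ->]]] [n [t [Mn t0 ->]]].
    exists (m + n), (s + t); split; [exact: MD|exact: addr_ge0|].
    by rewrite scalerDl addrACA.
  - move=> t _ t0 [m [s [Mm s0 ->]]]; exists (t *: m), (t * s).
    split; [exact: MZ|exact: mulr_ge0|].
    by rewrite scalerDr scalerA.
  - by move=> _ [m [s [Mm s0 ->]]]; exact: xU.
have UM : U `<=` M.
  move=> u Uu; apply: Mray => m s Mm s0 Uv.
  have s1 : 0 < 1 + s by rewrite ltr_pwDl.
  apply: (MU ((1 + s)^-1 *: m)); first by apply: MZ => //; rewrite invr_ge0 ltW.
  have [s00|sneq0] := eqVneq s 0.
    by move: Uv; rewrite s00 addr0 invr1 scale1r scale0r addr0.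
  have := cU (1 + s)^-1 _ _ _ _ Uv Uu; rewrite invr_gt0 s1.
  rewrite invf_lt1// ltrDl lt0r sneq0 s0 => /(_ isT isT).
  congr U; rewrite scalerN scalerDr scalerA opprD -addrA.
  rewrite [X in _ + X](_ : _ = 0) ?addr0//.
  apply/eqP; rewrite addrC subr_eq0; apply/eqP; congr (_ *: _).
  by field; rewrite gt_eqF.
exists M; split => // x; apply: contrapT => /not_orP[nMx nMNx].
apply: nMx; apply: Mray => m s Mm s0 Uv; apply: nMNx.
have sneq0 : s != 0.
  apply/eqP => s00; move: Uv; rewrite s00 scale0r addr0; exact: MU.
rewrite (_ : - x = s^-1 *: (m - (m + s *: x))); last first.
  by rewrite opprD addrA subrr add0r scalerN scalerA mulVf// scale1r.
by apply: MZ; [rewrite invr_ge0|apply: MD => //; exact: UM].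
Qed.

Section Separation.
Context {R : realType} {E : tvsType R}.

(** With [M] as in [maximal_cone] and [u] in [U], the sets [D x] are downward
closed rays of the real line, bounded since [U] absorbs.  The map [f] is
superadditive because [M] is closed under sums, and odd because every vector
or its opposite is in [M]; together these make it linear.  It is positive on
[U], hence bounded by [f u] on a neighbourhood of [0], hence continuous. *)
Lemma separation_open0 (U : set E) : open U -> convex_set U -> U !=set0 ->
  ~ U 0 -> exists f : contLinear E R^o, forall x, U x -> 0 < f x.
Proof.
move=> oU cU [u Uu] U0.
have [M [MD MZ UM MU Mtot]] := maximal_cone cU U0.
have Mu : M u := UM _ Uu.
pose D x := [set t : R | M (x - t *: u)].
pose f x : R^o := sup (D x).
have Dle x s t : D x t -> s <= t -> D x s.
  rewrite /D/= => Mt st.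
  rewrite (_ : x - s *: u = (x - t *: u) + (t - s) *: u).
    by apply: MD => //; apply: MZ => //; rewrite subr_ge0.
  by rewrite scalerBl addrA subrK.
have Dsup x : has_sup (D x).
  have [e e0 eU] := open_absorbing x oU Uu; split.
    exists (- e^-1); rewrite /D/= scaleNr opprK.
    rewrite (_ : x + _ = e^-1 *: (u + e *: x)).
      by apply: MZ; [rewrite invr_ge0 ltW|apply/UM/eU; rewrite gtr0_norm].
    by rewrite scalerDr scalerA mulVf ?gt_eqF// scale1r addrC.
  exists e^-1 => t Dt; rewrite leNgt; apply/negP => te.
  have /(MZ e) := Dle _ _ _ Dt (ltW te); rewrite ltW// => /(_ isT)/MU; apply.
  rewrite -scalerN opprB scalerBr scalerA divff ?gt_eqF// scale1r -scaleNr.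
  by apply: eU; rewrite normrN gtr0_norm.
have Df x t : D x t -> t <= f x.
  by move=> Dt; apply: sup_upper_bound.
have fleP x c : (forall t, D x t -> t <= c) -> f x <= c.
  by move=> xc; apply: ge_sup => //; case: (Dsup x).
have f0 : f 0 = 0.
  apply/eqP; rewrite eq_le; apply/andP; split; last first.
    by apply: Df; rewrite /D/= scale0r subr0 -(scale0r u); exact: MZ.
  apply: fleP => t; rewrite /D/= sub0r => Mt; rewrite leNgt; apply/negP => t0.
  have : M (t^-1 *: (- (t *: u))) by apply: MZ; rewrite // invr_ge0 ltW.
  rewrite scalerN scalerA mulVf ?gt_eqF// scale1r => /MU.
  by rewrite opprK.
have fsuper x y : f x + f y <= f (x + y).
  rewrite -lerBrDr; apply/fleP => s Ds; rewrite lerBrDr [s + _]addrC -lerBrDr.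
  apply: fleP => t Dt; rewrite lerBrDr; apply: Df; rewrite /D/=.
  rewrite (_ : _ - _ = (x - s *: u) + (y - t *: u)); first exact: MD.
  by rewrite [t + s]addrC scalerDl opprD addrACA.
have fN x : f (- x) = - f x.
  apply/eqP; rewrite eq_le; apply/andP; split.
    by rewrite -subr_le0 opprK -f0 -(addNr x); exact: fsuper.
  rewrite leNgt; apply/negP => ft.
  have [s fs st] : exists2 s, f x < s & s < - f (- x).
    by exists ((f x - f (- x)) / 2); lra.
  have [/Df|Mx] := Mtot (x - s *: u); first lra.
  have /Df : D (- x) (- s) by rewrite /D/= scaleNr -opprD.
  lra.
have fD x y : f (x + y) = f x + f y.
  apply/eqP; rewrite eq_le fsuper andbT.
  have := fsuper (- x) (- y); rewrite -opprD !fN; lra.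
have fZ_ge t x : 0 < t -> t * f x <= f (t *: x).
  move=> t0; rewrite mulrC -ler_pdivlMr//; apply: fleP => s Ds.
  rewrite ler_pdivlMr// mulrC; apply: Df; rewrite /D/= -scalerA -scalerBr.
  by apply: MZ => //; exact: ltW.
have fZ_pos t x : 0 < t -> f (t *: x) = t * f x.
  move=> t0; apply/eqP; rewrite eq_le fZ_ge// andbT.
  have tV : 0 < t^-1 by rewrite invr_gt0.
  have := @fZ_ge t^-1 (t *: x) tV.
  by rewrite scalerA mulVf ?gt_eqF// scale1r mulrC ler_pdivrMr// mulrC.
have fZ t x : f (t *: x) = t * f x.
  have [t0|t0|<-] := ltgtP 0 t; [exact: fZ_pos| |by rewrite scale0r mul0r].
  by rewrite -[t in LHS]opprK scaleNr fN fZ_pos ?oppr_gt0// mulNr opprK.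
have flin : linear f by move=> a x y; rewrite fD fZ.
have fpos x : U x -> 0 < f x.
  move=> Ux; have [e e0 eU] := open_absorbing u oU Ux.
  apply: (lt_le_trans e0); apply: Df; rewrite /D/= -scaleNr.
  by apply/UM/eU; rewrite normrN gtr0_norm.
have fcont : continuous (f : E -> R^o).
  move=> a; apply/cvgrPdist_lt => e e0.
  have fu := fpos _ Uu.
  (* Where both [u + k (y - a)] and [u - k (y - a)] are in [U], positivity of
     [f] gives [k |f (y - a)| < f u = k e]. *)
  pose k := f u / e.
  have kgt0 : 0 < k by rewrite divr_gt0.
  have nearU c : \forall y \near a, U (u + c *: (y - a)).
    have : nbhs (u + c *: (a - a)) U.
      by rewrite subrr scaler0 addr0; exact: open_nbhs_nbhs.
    exact: (@continuous_affine R E u (- a) c a U).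
  near=> y.
  have : U (u + k *: (y - a)) by near: y; exact: nearU.
  have : U (u + (- k) *: (y - a)) by near: y; exact: nearU.
  move=> /fpos + /fpos.
  rewrite !fD !fZ fD fN => h1 h2.
  rewrite ltr_norml.
  have ke : k * e = f u by rewrite /k divfK// gt_eqF.
  apply/andP; split.
    rewrite -(ltr_pM2l kgt0) mulrN ke; lra.
  rewrite -(ltr_pM2l kgt0) ke; lra.
have [L LE] := exists_contLinear flin fcont.
by exists L => x Ux; rewrite LE; exact: fpos.
Unshelve. all: by end_near. Qed.

(** Local convexity gives an open convex neighbourhood [b] of [p] that misses
[A]; a functional positive on [A - b] is bounded below on [A] by its value at
any point of [b], and [b] contains points where it exceeds its value at [p]. *)
Lemma separation_closed (A : set E) (p : E) : closed A -> convex_set A ->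
  A !=set0 -> ~ A p ->
  exists (f : contLinear E R^o) (c : R), f p < c /\ forall a, A a -> c <= f a.
Proof.
move=> clA /convex_setP cA [a0 Aa0] nAp.
have [B Bconv [Bo Bb]] := @locally_convex R E.
have [b [Bb' bp] bA] : exists2 b, B b /\ b p & b `<=` ~` A.
  have : nbhs p (~` A).
    by apply: open_nbhs_nbhs; split => //; exact: closed_openC.
  by move=> /Bb.
have /convex_setP bconv : convex_set b by apply: Bconv; exact: mem_set.
have bo : open b := Bo _ Bb'.
(* [A - b], written as a union of preimages of [b] so that it is open *)
pose U := \bigcup_(a in A) [set y | b (a + (-1) *: (y + 0))].
have UE a v : A a -> b v -> U (a - v).
  by move=> Aa bv; exists a => //=; rewrite addr0 scaleN1r opprB addrC subrK.
have Uo : open U.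
  apply: bigcup_open => a Aa.
  rewrite (_ : [set _ | _] = (fun y => a + (-1) *: (y + 0)) @^-1` b)//.
  by apply: open_comp => // y _; exact: continuous_affine.
have cU : convex_set U.
  apply/convex_setP => t x y t0 t1 [a Aa /= bx] [a' Aa' /= by_].
  exists (t *: a + (1 - t) *: a'); first exact: cA.
  move: (bconv t _ _ t0 t1 bx by_); rewrite /= !addr0 !scaleN1r !scalerBr.
  by congr b; rewrite addrACA opprD.
have U0 : ~ U 0.
  by move=> [a Aa] /=; rewrite addr0 scaler0 addr0 => /bA.
have [f fU] := separation_open0 Uo cU (ex_intro _ _ (UE _ _ Aa0 bp)) U0.
have fd : 0 < f (a0 - p) := fU _ (UE _ _ Aa0 bp).
have [e e0 eb] := open_absorbing (a0 - p) bo bp.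
have bv : b (p + e *: (a0 - p)) by apply: eb; rewrite gtr0_norm.
exists f, (f (p + e *: (a0 - p))); split.
  by rewrite linearD linearZ/= ltrDl mulr_gt0.
move=> a Aa; have := fU _ (UE _ _ Aa bv); rewrite linearB/= subr_gt0.
exact: ltW.
Qed.

End Separation.

(** * Sums of closed, compact and convex sets *)

(** If [p] is not in [A + B], then each [p - b] with [b] in [B] has a
neighbourhood outside [A]; compactness makes the choice uniform in [b]. *)
Lemma closed_add_compact (R : realType) (E : tvsType R) (A B : set E) :
  closed A -> compact B -> closed [set a + b | a in A & b in B].
Proof.
move=> clA /compact_near_coveringP cB.
rewrite -[X in closed X]setCK; apply: open_closedC; rewrite openE => p np.
have : \forall q \near p, B `<=` [set b | ~ A (q - b)].
  apply: cB => b Bb.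
  have : nbhs (p - b) (~` A).
    apply: open_nbhs_nbhs; split; first exact: closed_openC.
    move=> Apb; apply: np; exists (p - b) => //.
    by exists b => //; rewrite subrK.
  move=> /(@sub_continuous E (p, b))[[P Q] /= [pP bQ] PQA].
  by exists (Q, P) => //= -[b' p'] /= [Qb Pp]; exact: (PQA (p', b')).
apply: filterS => q qB [a Aa] [b Bb] abq.
by apply: (qB b Bb); rewrite -abq addrK.
Qed.

Lemma convex_add (R : realType) (V : lmodType R) (A B : set V) :
  convex_set A -> convex_set B -> convex_set [set a + b | a in A & b in B].
Proof.
move=> /convex_setP cA /convex_setP cB; apply/convex_setP.
move=> t _ _ t0 t1 [a Aa [b Bb <-]] [a' Aa' [b' Bb' <-]].
exists (t *: a + (1 - t) *: a'); first exact: cA.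
exists (t *: b + (1 - t) *: b'); first exact: cB.
by rewrite !scalerDr addrACA.
Qed.

Lemma compact_add (R : realType) (E : tvsType R) (A B : set E) :
  compact A -> compact B -> compact [set a + b | a in A & b in B].
Proof.
move=> cA cB.
rewrite (_ : [set _ | _ in _ & _ in _] =
    (fun z : E * E => z.1 + z.2) @` (A `*` B)).
  apply: continuous_compact; last exact: compact_setX.
  by apply: continuous_subspaceT; exact: add_continuous.
apply/seteqP; split=> [_ [a Aa [b Bb <-]]|_ [[a b] [/= Aa Bb] <-]].
  by exists (a, b).
by exists a => //; exists b.
Qed.

(** The set is the Minkowski sum of the segments [[-v, v]], built one point at
a time so that compactness and convexity pass through [compact_add] and
[convex_add]. *)
Lemma finite_subset_compact_convex (R : realType) (E : tvsType R) (s : seq E) :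
  exists B : set E, [/\ compact B, convex_set B, B 0 &
    forall v, v \in s -> B v /\ B (- v)].
Proof.
elim: s => [|v s [B [cB /convex_setP convB B0 Bs]]].
  exists [set 0]; split => //; first exact: compact_set1.
  by apply/convex_setP => t _ _ _ _ -> ->; rewrite /= !scaler0 addr0.
pose T := (fun t : R => t *: v) @` `[(-1), 1].
have T0 : T 0 by exists 0; rewrite ?scale0r//= in_itv/= lerN10 ler01.
exists [set b + t | b in B & t in T]; split.
- apply: compact_add => //; apply: continuous_compact;
    last exact: segment_compact.
  apply: continuous_subspaceT => t.
  rewrite (_ : (fun _ => _) = (fun t => 0 + t *: v)); last first.
    by apply/funext => ?; rewrite add0r.
  exact: continuous_affine_line.
- apply: convex_add; first exact/convex_setP.
  apply/convex_setP => t _ _ t0 t1 [a /= + <-] [b /= + <-].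
  rewrite !in_itv/= => /andP[a1 a2] /andP[b1 b2].
  exists (t * a + (1 - t) * b); last by rewrite scalerDl !scalerA.
  by rewrite /= in_itv/=; apply/andP; split; nra.
- by exists 0 => //; exists 0 => //; rewrite addr0.
- move=> w; rewrite inE => /predU1P[->|/Bs[Bw BNw]].
    split; exists 0 => //; [exists v|exists (- v)]; rewrite ?add0r//.
      by exists 1; rewrite ?scale1r//= in_itv/= lexx andbT; lra.
    by exists (-1); rewrite ?scaleN1r//= in_itv/= lexx/=; lra.
  by split; [exists w|exists (- w)] => //; exists 0; rewrite ?addr0.
Qed.

(** * Convex cones and weak suprema *)

Section Cones.
Context {R : realType} {V : tvsType R} (K : set V).
Hypotheses (Kconvex : convex_set K) (Kcone : is_cone K).

Lemma convex_coneD x y : K x -> K y -> K (x + y).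
Proof.
move=> Kx Ky; rewrite (_ : x + y = 2 *: (2^-1 *: x + (1 - 2^-1) *: y)).
  apply: Kcone => //; move/convex_setP : Kconvex; apply => //.
    by rewrite invf_lt1// ltr1n.
rewrite scalerDr !scalerA mulfV// scale1r.
by rewrite (_ : 2 * (1 - 2^-1) = 1) ?scale1r//; field.
Qed.

Lemma interior_coneD x k : K° x -> K k -> K° (x + k).
Proof.
move=> Kx Kk; have : nbhs (x + k) [set k + z | z in K].
  by rewrite addrC; exact: nbhsB.
by apply: filterS => _ [z Kz <-]; exact: convex_coneD.
Qed.

Lemma interior_coneZ t x : 0 < t -> K° x -> K° (t *: x).
Proof.
move=> t0 Kx; have : nbhs (t *: x) [set t *: z | z in K].
  by apply: nbhsZ => //; rewrite gt_eqF.
by apply: filterS => _ [z Kz <-]; apply: Kcone => //; exact: ltW.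
Qed.

Lemma interior_cone_shrink x e : K° x -> exists2 t : R, 0 < t & K° (x - t *: e).
Proof.
move=> Kx; have [t t0 tK] := open_absorbing e (open_interior K) Kx.
by exists t => //; rewrite -scaleNr; apply: tK; rewrite normrN gtr0_norm.
Qed.

Lemma interior_cone_absorb e x : K° e -> exists2 t : R, 0 < t & K° (x + t *: e).
Proof.
move=> Ke; have [t t0 tK] := open_absorbing x (open_interior K) Ke.
exists t^-1; first by rewrite invr_gt0.
rewrite (_ : x + _ = t^-1 *: (e + t *: x)).
  by apply: interior_coneZ; rewrite ?invr_gt0//; apply: tK; rewrite gtr0_norm.
by rewrite scalerDr scalerA mulVf ?gt_eqF// scale1r addrC.
Qed.

Lemma ltK_fin (u v : V) : ltK K u%:E v%:E <-> K° (v - u).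
Proof.
rewrite /ltK /oppset /=; split=> [[k Kk kuv]|Kvu].
  by rewrite -opprB -kuv opprK.
by exists (v - u); rewrite ?opprB.
Qed.

(** For the converse, let [e] be interior to [K] and [s] the infimum of the [t]
for which nothing in [M] is strictly above [y + t e].  It is finite, since
[y + t e] falls below [v0] for very negative [t], and nonpositive; then
[y + s e] is a weak supremum and [y] exceeds it by [- s e]. *)
Lemma addset_WSupP (M : set (\bar V)) (y v0 : V) : K° !=set0 -> M v0%:E ->
  addset (WSup K M) K y%:E <-> forall v, M v -> ~ ltK K y%:E v.
Proof.
move=> [e Ke] Mv0.
have Kei : K e := interior_subset Ke.
split.
  move=> [[vb| |] [vbM _] [k Kk]] // [<-].
  move=> [v| |] Mv yv; [|exact: vbM Mv _|by []].
  apply: (vbM _ Mv); apply/ltK_fin; move/ltK_fin : yv.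
  by move=> /interior_coneD /(_ Kk); rewrite opprD addrA subrK.
move=> yM.
have yMfin v : M v%:E -> ~ K° (v - y) by move=> Mv /ltK_fin; exact: yM.
pose T := [set t : R | forall v, M v%:E -> ~ K° (v - (y + t *: e))].
have T0 : T 0 by move=> v Mv; rewrite scale0r addr0; exact: yMfin.
have Tup s t : T s -> s <= t -> T t.
  move=> Ts st v Mv Kv; apply: (Ts v Mv).
  rewrite (_ : v - _ = v - (y + t *: e) + (t - s) *: e).
    by apply: interior_coneD => //; apply: Kcone; rewrite ?subr_ge0.
  by rewrite scalerBl !opprD !addrA subrK.
have Tinf : has_inf T.
  split; first by exists 0.
  have [c c0 Kc] := interior_cone_absorb (v0 - y) Ke.
  exists (- c) => t Tt; rewrite leNgt; apply/negP => tc.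
  by apply: (Tup _ _ Tt (ltW tc) _ Mv0); rewrite scaleNr opprD opprK addrA.
(* [s] is kept abstract so that its definition as an opposite of a supremum
   is not rewritten. *)
have [s sE] : exists s, s = inf T by exists (inf T).
have s0 : s <= 0 by rewrite sE; apply: ge_inf => //; case: Tinf.
exists (y + s *: e)%:E; last first.
  exists (- s *: e); first by apply: Kcone; rewrite ?oppr_ge0.
  by rewrite scaleNr; exact: (congr1 EFin (addrK _ _)).
split.
  move=> [v| |] Mv; [|by have := yM _ Mv; exact|exact].
  move=> /ltK_fin Kv; have [d d0 Kd] := interior_cone_shrink e Kv.
  have [t Tt ts] : exists2 t, T t & t < s + d.
    by rewrite sE; exact: inf_adherent.
  apply: (Tup _ _ Tt (ltW ts) _ Mv).
  by rewrite scalerDl addrA opprD addrA.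
move=> [w| |] //; last by move=> _; exists v0%:E.
move=> /ltK_fin Kw; have [d d0 Kd] := interior_cone_shrink e Kw.
have : ~ T (s - d) by move=> /(ge_inf Tinf.2); rewrite -sE; lra.
move=> /existsNP[v /not_implyP[Mv /contrapT Kv]].
exists v%:E => //; apply/ltK_fin.
rewrite (_ : v - w = (v - (y + (s - d) *: e)) + (y + s *: e - w - d *: e)).
  by apply: interior_coneD => //; exact: interior_subset.
by rewrite scalerBl [y + (_ - _)]addrA [_ - w - _]addrAC addrA subrK.
Qed.

End Cones.

(** * The topology of pointwise convergence *)

Section PointwiseTopology.
Context {R : realType} {X Y : tvsType R}.

Lemma contLinear_eval_continuous (x : X) :
  continuous (fun L : contLinear X Y => L x).
Proof.
move=> L.
apply: (@continuous_comp _ {ptws X -> Y} _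
  (fun L : contLinear X Y => (L : {ptws X -> Y})) (fun f => f x)).
  exact: (@initial_continuous _ {ptws X -> Y}
    (fun L : contLinear X Y => (L : {ptws X -> Y}))).
exact: proj_continuous.
Qed.

(** The sets of maps sending finitely many points into a neighbourhood of [0]
generate a filter that converges pointwise to [0], so it refines the
neighbourhood filter of [0]. *)
Lemma nbhs_contLinear0 (A : set (contLinear X Y)) : nbhs (contLinear0 X Y) A ->
  exists (s : seq X) (U : set Y), nbhs 0 U /\
    forall L : contLinear X Y, (forall x, x \in s -> U (L x)) -> A L.
Proof.
pose Phi : set_system {ptws X -> Y} :=
  [set B | exists (s : seq X) (U : set Y), nbhs 0 U /\
    forall f, (forall x, x \in s -> U (f x)) -> B f].
have PhiF : Filter Phi.
  split.
  - by exists [::], setT; split => //; exact: filterT.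
  - move=> P Q [s [U [U0 sP]]] [t [W [W0 tQ]]].
    exists (s ++ t), (U `&` W); split; first exact: filterI.
    move=> f fUW; split.
      by apply: sP => x xs; apply: (fUW x _).1; rewrite mem_cat xs.
    by apply: tQ => x xs; apply: (fUW x _).2; rewrite mem_cat xs orbT.
  - move=> P Q PQ [s [U [U0 sP]]]; exists s, U; split => // f /sP; exact: PQ.
have Phi0 : {ptws, Phi --> (fun _ : X => 0 : Y)}.
  apply/pointwise_cvgP => x U U0; exists [:: x], U; split => // f; apply.
  by rewrite inE.
rewrite nbhsE => -[B [[W oW WB] B0] BA].
have : nbhs ((fun _ : X => 0) : {ptws X -> Y}) W.
  apply: open_nbhs_nbhs; split => //.
  by move: B0; rewrite -WB.
move=> /Phi0[s [U [U0 sW]]]; exists s, U; split => // L LU.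
by apply: BA; rewrite -WB; exact: sW.
Qed.

End PointwiseTopology.

(** * Approximate multipliers for scalar problems *)

Lemma closed_epigraph (R : realType) (X : topologicalType) (f : X -> \bar R) :
  lower_semicontinuous f -> closed [set p : X * R^o | (f p.1 <= p.2%:E)%E].
Proof.
move=> flsc; rewrite -[X in closed X]setCK; apply: open_closedC.
rewrite openE => -[x r] /= /negP; rewrite -ltNge => rf.
have [a ra af] : exists2 a : R, r < a & (a%:E < f x)%E.
  case: (f x) rf => [y|_|//].
    by rewrite lte_fin => ry; exists ((r + y) / 2); rewrite ?lte_fin; lra.
  by exists (r + 1); rewrite ?ltry// ltrDl.
have [V xV Vf] := flsc _ _ af.
exists (V, [set t : R^o | t < a]) => /=.
  by split => //; exact: lt_nbhsl.
move=> [y t] [/= Vy ta]; apply/negP; rewrite -ltNge.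
by apply: lt_trans (Vf _ Vy); rewrite lte_fin.
Qed.

Lemma epiKP (X : Type) (Y : zmodType) (K : set Y) (F : X -> \bar Y) x w :
  epiK K F (x, w) <-> exists2 y, F x = y%:E & K (w - y).
Proof.
rewrite /epiK /addset /=; split=> [[_ -> [k Kk]]|[y Fx Kwy]].
  by case: (F x) => // y [<-]; exists y => //; rewrite addrAC subrr add0r.
exists (F x) => //; exists (w - y) => //; rewrite Fx.
by congr EFin; rewrite addrC subrK.
Qed.

Lemma feasible_setP (R : realType) (X Z : tvsType R) (C : set X) (S : set Z)
  (G : X -> \bar Z) x : feasible_set C S G x <-> C x /\ epiK S G (x, 0).
Proof.
split=> -[Cx].
  move=> [z [k Sk kz] /esym Gx]; split => //; apply/epiKP; exists z => //.
  by rewrite -kz sub0r opprK.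
move=> /epiKP[z Gx Sz]; split => //; exists z; rewrite //=.
by exists (- z); rewrite ?opprK// -sub0r.
Qed.

Section ScalarDuality.
Context {R : realType} {X Z : tvsType R}.
Variables (S : set Z) (C : set X) (f : X -> \bar R) (G : X -> \bar Z).
Hypotheses (Sconvex : convex_set S) (Scone : is_cone S) (S0 : S 0).
Hypotheses (Cclosed : closed C) (Cconvex : convex_set C).
Hypotheses (flsc : lower_semicontinuous f)
  (fconvex : convex_set [set p : X * R^o | (f p.1 <= p.2%:E)%E]).
Hypotheses (Gconvex : K_convex S G) (Gclosed : K_epi_closed S G).

(** The value [r - m] and the functional [xs] are the error terms: with both
equal to zero the conclusion would be the exact Lagrange multiplier rule,
which fails in general without a constraint qualification. *)
Lemma approximate_multiplier (xb : X) (m : R) : feasible_set C S G xb ->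
    f xb = m%:E -> (forall x, feasible_set C S G x -> (f xb <= f x)%E) ->
  forall (s : seq X) (e : R), 0 < e ->
  exists (xs : contLinear X R^o) (zs : contLinear Z R^o) (r : R),
    [/\ forall v, v \in s -> `|xs v| <= e, forall z, S z -> 0 <= zs z,
        `|r - m| <= e &
        forall x z t, C x -> G x = z%:E -> f x = t%:E -> xs x + r <= t + zs z].
Proof.
move=> xbF fxb fmin s e0 e0_gt0; pose e := e0 / 2.
have e_gt0 : 0 < e by rewrite divr_gt0.
pose W := (X * Z * R^o)%type.
pose E : set W := [set w | [/\ C w.1.1, epiK S G w.1 & (f w.1.1 <= w.2%:E)%E]].
have Eclosed : closed E.
  rewrite (_ : E = ((fun w : W => w.1.1) @^-1` C) `&` (fst @^-1` (epiK S G)) `&`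
      ((fun w : W => (w.1.1, w.2)) @^-1`
        [set p | (f p.1 <= p.2%:E)%E])); last first.
    by apply/seteqP; split=> w [] => [? ? ?|[? ?] ?].
  have c11 : continuous (fun w : W => w.1.1).
    move=> w; apply: (@continuous_comp _ (X * Z)%type _ fst fst);
      exact: cvg_fst.
  have c112 : continuous (fun w : W => (w.1.1, w.2)).
    move=> w; apply: (@cvg_pair _ _ _ _ (nbhs w.1.1) (nbhs w.2)).
      exact: c11.
    exact: cvg_snd.
  apply: closedI; first apply: closedI.
  - by move/continuous_closedP : c11; apply.
  - have c1 : continuous (fst : W -> (X * Z)%type) by move=> w; exact: cvg_fst.
    by move/continuous_closedP : c1; apply.
  - by move/continuous_closedP : c112; apply; exact: closed_epigraph.
have Econvex : convex_set E.
  move/convex_setP: Cconvex => cC; move/convex_setP: Gconvex => cG.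
  move/convex_setP: fconvex => cf.
  apply/convex_setP => t [[x z] r] [[x' z'] r'] t0 t1.
  move=> [/= Cx Gx fx] [/= Cx' Gx' fx'].
  split => /=; first exact: cC.
    exact: (cG t (x, z) (x', z')).
  exact: (cf t (x, r) (x', r')).
(* [xb] is included because the distance from the separating level to [m] also
   involves the value of the functional at [xb]; the two errors add up, hence
   the factor 2 between [e0] and [e]. *)
have [B [Bcompact Bconvex B0 Bs]] := finite_subset_compact_convex (xb :: s).
pose i1 (x : X) : W := (x, 0, 0).
have i1lin : linear i1.
  by move=> a x y; congr (_, _, _) => /=; rewrite scaler0 addr0.
have i1cont : continuous i1.
  move=> x; apply: (@cvg_pair _ _ _ _ (nbhs (x, 0 : Z)) (nbhs (0 : R^o))).
    by apply: cvg_pair; [exact: cvg_id|exact: cvg_cst].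
  exact: cvg_cst.
pose i2 (z : Z) : W := (0, z, 0).
have i2lin : linear i2.
  by move=> a x y; congr (_, _, _) => /=; rewrite scaler0 addr0.
have i2cont : continuous i2.
  move=> z; apply: (@cvg_pair _ _ _ _ (nbhs (0 : X, z)) (nbhs (0 : R^o))).
    by apply: cvg_pair; [exact: cvg_cst|exact: cvg_id].
  exact: cvg_cst.
pose E' := [set a + b | a in E & b in i1 @` B].
have E'closed : closed E'.
  apply: closed_add_compact => //; apply: continuous_compact => //.
  exact: continuous_subspaceT.
have E'convex : convex_set E'.
  apply: convex_add => //; move/convex_setP: Bconvex => cB; apply/convex_setP.
  move=> t _ _ t0 t1 [b Bb <-] [b' Bb' <-]; exists (t *: b + (1 - t) *: b').
    exact: cB.
  by congr (_, _, _) => /=; rewrite !scaler0 addr0.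
have [Cxb Gxb] := (feasible_setP _ _ _ _).1 xbF.
have Exb z : S z -> E (xb, z, m).
  move=> Sz; split => //=; last by rewrite fxb.
  have [_ [zb [k Sk kz] Gz]] := xbF; apply/epiKP; exists zb => //.
  by rewrite -kz opprK; exact: convex_coneD.
have E'0 : E' !=set0.
  exists ((xb, 0, m) + i1 0), (xb, 0, m); first exact: Exb.
  by exists (i1 0) => //; exists 0.
have np : ~ E' (xb, 0, m - e).
  move=> [[[x z] r] [/= Cx Gx fx] [_ [b Bb <-] /= [_]]].
  rewrite !addr0 => z0 rE; subst z.
  have : (f xb <= f x)%E by apply/fmin/feasible_setP.
  move=> /le_trans /(_ fx); rewrite fxb rE lee_fin; lra.
have [g [c [gp gE']]] := separation_closed E'closed E'convex E'0 np.
have glin a u v : g (a *: u + v) = a * g u + g v by rewrite linearD linearZ.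
have [xs xsE] : exists L : contLinear X R^o, forall x, L x = g (i1 x).
  apply: exists_contLinear; first by move=> a x y; rewrite i1lin glin.
  move=> x; apply: continuous_comp; first exact: i1cont.
  exact: contLinear_cont.
have [zs zsE] : exists L : contLinear Z R^o, forall z, L z = g (i2 z).
  apply: exists_contLinear; first by move=> a x y; rewrite i2lin glin.
  move=> x; apply: continuous_comp; first exact: i2cont.
  exact: contLinear_cont.
pose a : R := g (0, 0, 1).
have gE x z r : g (x, z, r) = xs x + zs z + r * a.
  rewrite xsE zsE /a -[r * _]linearZ -!linearD.
  congr (g (_, _, _)) => /=; rewrite ?scaler0 ?addr0 ?add0r//.
  by rewrite -[RHS]/(r * 1) mulr1.
have Ec w b : E w -> B b -> c <= g w + xs b.
  move=> Ew Bb; rewrite xsE -linearD; apply: gE'; exists w => //.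
  by exists (i1 b) => //; exists b.
have xs0 : xs 0 = 0 by rewrite linear0.
have zs0 : zs 0 = 0 by rewrite linear0.
move: gp; rewrite gE zs0 addr0 => gp.
(* The functional is not vertical: the point [(xb, 0, m)] of [E] lies above the
   excluded point [(xb, 0, m - e)]. *)
have a_gt0 : 0 < a.
  have := Ec _ _ (Exb _ S0) B0; rewrite gE xs0 zs0 !addr0 => cg.
  by rewrite -(pmulr_rgt0 a e_gt0); lra.
have normaV : `|a^-1| = a^-1 by rewrite gtr0_norm ?invr_gt0.
have xsB b : B b -> - (a * e) < xs b.
  move=> Bb; have := Ec _ _ (Exb _ S0) Bb; rewrite gE zs0 !addr0; lra.
have xs_small v : v \in xb :: s -> `|xs v| < a * e.
  move=> /Bs[/xsB Bv /xsB]; rewrite linearN => BNv.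
  by rewrite ltr_norml Bv/=; lra.
have [xsV xsVE] : exists L : contLinear X R^o, forall x, L x = - a^-1 * xs x.
  apply: exists_contLinear.
    by move=> k x y; rewrite linearD linearZ /= mulrDr mulrCA.
  by move=> x; apply: cvgMr; exact: contLinear_cont.
have [zsV zsVE] : exists L : contLinear Z R^o, forall x, L x = a^-1 * zs x.
  apply: exists_contLinear.
    by move=> k x y; rewrite linearD linearZ /= mulrDr mulrCA.
  by move=> x; apply: cvgMr; exact: contLinear_cont.
exists xsV, zsV, (a^-1 * c); split.
- move=> v vs; rewrite xsVE normrM normrN normaV.
  rewrite ler_pdivrMl//; have := @xs_small v; rewrite inE vs orbT => /(_ isT).
  by move/ltW/le_trans; apply; rewrite ler_pM2l// /e; lra.
- move=> z Sz; rewrite zsVE mulr_ge0 ?invr_ge0 ?(ltW a_gt0)// leNgt.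
  apply/negP => zneg.
  have cxb : c <= xs xb + m * a.
    by have := Ec _ _ (Exb _ S0) B0; rewrite gE xs0 zs0 !addr0.
  (* the multiple of [z] at which the bound [c] is violated by one *)
  pose k := (xs xb + m * a - c + 1) / - zs z.
  have k0 : 0 <= k by rewrite divr_ge0//; lra.
  have := Ec _ _ (Exb _ (Scone k0 Sz)) B0; rewrite gE linearZ/= xs0 addr0.
  rewrite (_ : k *: zs z = - (xs xb + m * a - c + 1)); first lra.
  by rewrite /k -[_ *: _]/(_ * _); field; rewrite lt_eqF.
- rewrite (_ : _ - m = a^-1 * (c - m * a)); last by field; rewrite gt_eqF.
  rewrite normrM normaV ler_pdivrMl// ler_norml.
  have := Ec _ _ (Exb _ S0) B0; rewrite gE xs0 zs0 !addr0.
  have := @xs_small xb; rewrite mem_head ltr_norml => /(_ isT)/andP[].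
  have -> : e0 = 2 * e by rewrite /e; field.
  move=> h1 h2 h3; apply/andP; split; lra.
- move=> x z t Cx Gx fx.
  have Ew : E (x, z, t).
    by split => //=; [apply/epiKP; exists z; rewrite ?subrr|rewrite fx].
  have := Ec _ _ Ew B0; rewrite xs0 addr0 gE xsVE zsVE => h.
  rewrite -(ler_pM2l a_gt0) !mulrDr mulNr mulrN !mulrA divff ?gt_eqF//.
  rewrite !mul1r; lra.
Qed.

End ScalarDuality.

(** * The vector problem *)

Section VectorOptimization.
Context {R : realType} {X Y Z : tvsType R}.
Variables (K : set Y) (S : set Z) (C : set X).
Variables (F : X -> \bar Y) (G : X -> \bar Z).
Hypotheses (Kconvex : convex_set K) (Kcone : is_cone K) (Kint : K° !=set0).
Hypotheses (Sne : S !=set0) (Sconvex : convex_set S) (Scone : is_cone S).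
Hypotheses (Cclosed : closed C) (Cconvex : convex_set C).
Hypotheses (Fproper : proper_mapping F) (Fconvex : K_convex K F).
Hypothesis (Flsc : forall ystar : top_dual Y,
  lower_semicontinuous (fun x => er_map ystar (F x) : \bar R)).
Hypotheses (Gproper : proper_mapping G) (Gconvex : K_convex S G)
  (Gclosed : K_epi_closed S G).
Let K0 : K 0.
Proof.
have [e /interior_subset Ke] := Kint.
by rewrite -(scale0r e); exact: Kcone.
Qed.

Variables (xb : X) (yb : Y).
Hypotheses (xbF : feasible_set C S G xb) (Fxb : F xb = yb%:E).

(** The second half of the definition of a weak infimum is automatic at an
element of the set. *)
Lemma weak_solutionP : weak_solution K S C F G xb <->
  forall x y, feasible_set C S G x -> F x = y%:E -> ~ K° (yb - y).
Proof.
split=> [[_ [_ [+ _]]] x y xF Fx Kyb|noK].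
  by move=> /(_ y%:E); rewrite Fxb; apply; [exists x|exact/ltK_fin].
split => //; split; first by exists xb.
split=> [_ [x xF <-]|w Fw]; last by exists (F xb) => //; exists xb.
rewrite Fxb; case Fx: (F x) => [y| |] //.
  by move=> /ltK_fin; exact: noK Fx.
by move=> _; apply: Fproper.2; exists x.
Qed.

(** Only the points where [F] and [G] are finite and [C] holds count, because
elsewhere the conjugated value is [-oo], which is strictly above nothing. *)
Lemma lagrangian_conjP (T : contLinear Z Y) (L : contLinear X Y) (y : Y) :
  addset (conj_map K (lagrangian C F G T) L) K y%:E <->
  forall x u z, C x -> F x = u%:E -> G x = z%:E -> ~ K° (L x - (u + T z) - y).
Proof.
have lagE x u z : C x -> F x = u%:E -> G x = z%:E ->
    lagrangian C F G T x = (u + T z)%:E.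
  move=> Cx Fx Gx; rewrite /lagrangian /indic_ext Fx Gx asboolT//=.
  by congr EFin; rewrite addr0.
have [Cxb [zb _ /esym Gxb]] := xbF.
have := @addset_WSupP R Y K Kconvex Kcone
  (range (fun x => (L x)%:E - lagrangian C F G T x)%E) y
  (L xb - (yb + T zb)) Kint.
rewrite /conj_map => ->; last first.
  by exists xb => //; rewrite (lagE _ _ _ Cxb Fxb Gxb).
split=> [noK x u z Cx Fx Gx Ku|noK _ [x _ <-]].
  apply: (noK (L x - (u + T z))%:E); last exact/ltK_fin.
  by exists x => //; rewrite (lagE _ _ _ Cx Fx Gx).
case Fx: (F x) => [u| |]; last by exfalso; apply: Fproper.2; exists x.
  case Gx: (G x) => [z| |]; last by exfalso; apply: Gproper.2; exists x.
    have [Cx|nCx] := pselect (C x).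
      by rewrite (lagE _ _ _ Cx Fx Gx) => /ltK_fin; exact: noK Fx Gx.
    by rewrite /lagrangian /indic_ext asboolF// Fx Gx.
  by rewrite /lagrangian Fx Gx /indic_ext; case: ifP => _ [].
have Gx : G x <> -oo%E by move=> Gx; apply: Gproper.2; exists x.
rewrite /lagrangian Fx /indic_ext.
by case: ifP => _; case: (G x) Gx => [?| |] // _ [].
Qed.

(** Adding the open set [int K] to the values makes the set to be separated
open, and weak optimality says precisely that it misses [0]. *)
Lemma scalarization : weak_solution K S C F G xb ->
  exists ys : contLinear Y R^o, [/\ forall k, K° k -> 0 < ys k,
    forall k, K k -> 0 <= ys k &
    forall x y, feasible_set C S G x -> F x = y%:E -> ys yb <= ys y].
Proof.
move=> /weak_solutionP noK; have [e Ke] := Kint.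
pose I := [set p : X * Y | feasible_set C S G p.1 /\ F p.1 = p.2%:E].
(* the vectors [F x - yb + k] with [x] feasible and [k] interior to [K] *)
pose U := \bigcup_(p in I) [set v | K° (yb - p.2 + 1 *: (v + 0))].
have UP v : U v <-> exists x y,
    [/\ feasible_set C S G x, F x = y%:E & K° (v - (y - yb))].
  split=> [[[x y] [/= xF Fx]]|[x [y [xF Fx Kv]]]].
    by rewrite scale1r addr0 => Kv; exists x, y; split; rewrite // opprB addrC.
  by exists (x, y) => //=; rewrite scale1r addr0 addrC -opprB.
have Uo : open U.
  apply: bigcup_open => -[x y] _ /=.
  rewrite (_ : [set _ | _] = (fun v => yb - y + 1 *: (v + 0)) @^-1` K°)//.
  apply: open_comp; last exact: open_interior.
  by move=> v _; exact: continuous_affine.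
have Ucvx : convex_set U.
  apply/convex_setP => t v v' t0 t1.
  move=> /UP[x [y [xF Fx Kv]]] /UP[x' [y' [xF' Fx' Kv']]]; apply/UP.
  have [Cx Gx] := (feasible_setP _ _ _ _).1 xF.
  have [Cx' Gx'] := (feasible_setP _ _ _ _).1 xF'.
  have ct : 0 < 1 - t by rewrite subr_gt0.
  have epiF p q : F p = q%:E -> epiK K F (p, q).
    by move=> Fp; apply/epiKP; exists q; rewrite // subrr.
  have /epiKP[u Fu Ku] := (convex_setP _).1 Fconvex t _ _ t0 t1
    (epiF _ _ Fx) (epiF _ _ Fx').
  exists (t *: x + (1 - t) *: x'), u; split => //.
    apply/feasible_setP; split; first exact: (convex_setP _).1.
    have := (convex_setP _).1 Gconvex t _ _ t0 t1 Gx Gx'.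
    by congr epiK; congr (_, _); rewrite /= !scaler0 addr0.
  have := interior_coneD Kconvex Kcone (interior_coneD Kconvex Kcone
    (interior_coneZ Kcone t0 Kv)
    (interior_subset (interior_coneZ Kcone ct Kv'))) Ku.
  congr (K° _); rewrite !scale_convB -[t *: yb + _]scalerDl [t + _]addrC.
  rewrite subrK scale1r.
  by rewrite !opprB -addrA [yb - _ + _]addrA subrK.
have U0 : ~ U 0.
  by move=> /UP[x [y [xF Fx]]]; rewrite sub0r opprB; exact: noK Fx.
have [|ys ysU] := separation_open0 Uo Ucvx _ U0.
  by exists e; apply/UP; exists xb, yb; split; rewrite // subrr subr0.
have ysK k : K° k -> 0 < ys k.
  by move=> Kk; apply/ysU/UP; exists xb, yb; split; rewrite // subrr subr0.
(* Nonstrict inequalities are limits of strict ones along [t e], as t -> 0. *)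
have limit a : (forall t, 0 < t -> 0 < a + t * ys e) -> 0 <= a.
  move=> apos; rewrite leNgt; apply/negP => a0.
  have := apos (- a / ys e); rewrite divr_gt0 ?ysK ?oppr_gt0// => /(_ isT).
  by rewrite divfK ?gt_eqF ?ysK// subrr ltxx.
exists ys; split => // [k Kk|x y xF Fx].
  apply: limit => t t0; rewrite -[t * _]linearZ -linearD addrC; apply: ysK.
  by apply: interior_coneD => //; exact: interior_coneZ.
rewrite -subr_ge0; apply: limit => t t0.
rewrite -linearB -[t * _]linearZ -linearD addrC; apply/ysU/UP.
by exists x, y; split; rewrite // addrK; exact: interior_coneZ.
Qed.

Let epi_union := \bigcup_(T in Lplus S K) epiK_conj K (lagrangian C F G T).

Lemma convex_scalarized_epigraph (ys : contLinear Y R^o) :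
  (forall k, K k -> 0 <= ys k) ->
  convex_set [set p : X * R^o | (er_map ys (F p.1) <= p.2%:E :> \bar R)%E].
Proof.
move=> ysK; apply/convex_setP => t [x r] [x' r'] t0 t1 /=.
case Fx: (F x) => [u| |] //; last by exfalso; apply: Fproper.2; exists x.
case Fx': (F x') => [u'| |] //; last by exfalso; apply: Fproper.2; exists x'.
rewrite /= !lee_fin => ur ur'.
have epiF p q : F p = q%:E -> epiK K F (p, q).
  by move=> Fp; apply/epiKP; exists q; rewrite // subrr.
have /epiKP[v -> /ysK] := (convex_setP _).1 Fconvex t _ _ t0 t1
  (epiF _ _ Fx) (epiF _ _ Fx').
rewrite /= lee_fin linearB linearD !linearZ subr_ge0 => /le_trans; apply.
by rewrite lerD// ler_wpM2l// ltW// subr_gt0.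
Qed.

(** A scalar approximate multiplier [(xs, zs, r)] is lifted to
[L = xs e1], [T = zs e1] and [y = - yb + (ys yb - r) e1]. *)
Lemma closure_epi_union_weak_solution :
  weak_solution K S C F G xb -> closure epi_union (contLinear0 X Y, - yb).
Proof.
move=> /scalarization[ys [ysint ysK ysmin]].
have [e Ke] := Kint.
have yse : 0 < (ys e : R) by exact: ysint.
have [c c_gt0 cE] : exists2 c : R, 0 < c & c * ys e = 1.
  by exists (ys e : R)^-1; [rewrite invr_gt0|apply: mulVf; rewrite gt_eqF].
have [e1 Ke1 yse1] : exists2 e1, K e1 & ys e1 = 1.
  exists (c *: e); last by rewrite linearZ.
  by apply: interior_subset; exact: (interior_coneZ Kcone).
move=> B [[A1 A2] /= [/nbhs_contLinear0[s [U [U0 sA1]]] ybA2] AB].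
have [d1 d1_gt0 d1U] : exists2 d : R, 0 < d &
    forall t, `|t| <= d -> U (t *: e1).
  have [d d0 dU] := open_absorbing e1 (open_interior U) U0.
  by exists d => // t /dU; rewrite add0r; exact: interior_subset.
have [d2 d2_gt0 d2A] := open_absorbing e1 (open_interior A2) ybA2.
pose d := Num.min d1 d2.
have d_gt0 : 0 < d by rewrite lt_min d1_gt0.
have S0 : S 0 by have [z Sz] := Sne; rewrite -(scale0r z); exact: Scone.
have fmin x : feasible_set C S G x ->
    (er_map ys (F xb) <= er_map ys (F x) :> \bar R)%E.
  move=> xF; rewrite Fxb; case Fx: (F x) => [u| |] /=; [|by rewrite leey|].
    by rewrite lee_fin; exact: ysmin Fx.
  by exfalso; apply: Fproper.2; exists x.
have fxb : er_map ys (F xb) = (ys yb : R)%:E by rewrite Fxb.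
have [xs [zs [r [xss zsS rm H]]]] := approximate_multiplier Sconvex Scone S0
  Cclosed Cconvex (Flsc (ystar := ys)) (convex_scalarized_epigraph ysK)
  Gconvex Gclosed xbF fxb fmin s d_gt0.
have ray (V : tvsType R) (g : contLinear V R^o) :
    exists L : contLinear V Y, forall x, L x = g x *: e1.
  apply: exists_contLinear.
    by move=> a x y; rewrite linearP scalerDl scalerA.
  move=> x; apply: (@continuous_comp _ R^o _ g (fun t : R => t *: e1)).
    exact: contLinear_cont.
  rewrite (_ : (fun _ => _) = (fun t => 0 + t *: e1)).
    exact: continuous_affine_line.
  by apply/funext => ?; rewrite add0r.
have [L LE] := ray X xs.
have [T TE] := ray Z zs.
pose y := - yb + (ys yb - r) *: e1.
exists (L, y); split.
  exists T.
    by move=> _ [z Sz <-]; rewrite TE; apply: Kcone => //; exact: zsS.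
  apply/lagrangian_conjP => x u z Cx Fx Gx /ysint.
  rewrite LE TE !linearB !linearD linearN !linearZ/=.
  have := H x z (ys u) Cx Gx; rewrite Fx => /(_ erefl) h.
  rewrite -![_ *: _]/(_ * _ : R) yse1 !mulr1; lra.
apply: AB; split => /=.
  apply: sA1 => x xs'; rewrite LE; apply: d1U.
  by apply: le_trans (xss _ xs') _; rewrite ge_min lexx.
apply: interior_subset; apply: d2A; rewrite distrC; apply: le_trans rm _.
by rewrite ge_min lexx orbT.
Qed.

Lemma weak_solution_closure_epi_union :
  closure epi_union (contLinear0 X Y, - yb) -> weak_solution K S C F G xb.
Proof.
move=> clP; apply/weak_solutionP => x u [Cx [z0 [k Sk kz] /esym Gx]] Fx Kyb.
have nearK : nbhs (contLinear0 X Y, - yb)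
    [set p : contLinear X Y * Y | K° (p.1 x - p.2 - u)].
  have cont : continuous (fun p : contLinear X Y * Y => p.1 x - p.2 - u).
    move=> p; apply: (@continuous_comp _ (Y * Y)%type _
      (fun p : contLinear X Y * Y => (p.1 x - p.2, u)) (fun q => q.1 - q.2));
      last exact: sub_continuous.
    apply: cvg_pair => /=; last exact: cvg_cst.
    apply: (@continuous_comp _ (Y * Y)%type _
      (fun p : contLinear X Y * Y => (p.1 x, p.2)) (fun q => q.1 - q.2));
      last exact: sub_continuous.
    apply: cvg_pair => /=; last exact: cvg_snd.
    apply: (@continuous_comp _ _ _ fst (fun L : contLinear X Y => L x)).
      exact: cvg_fst.
    exact: contLinear_eval_continuous.
  apply: cont; apply: open_nbhs_nbhs; split; first exact: open_interior.
  by rewrite /= opprK add0r.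
have [[L y] /= [[T TSK /lagrangian_conjP noK] KLy]] := clP _ nearK.
apply: (noK _ _ _ Cx Fx Gx).
rewrite (_ : _ - _ = (L x - y - u) + T k).
  by apply: interior_coneD => //; apply: TSK; exists k.
by rewrite -kz linearN opprD opprK addrA [LHS]addrAC [_ - u - _]addrAC.
Qed.

End VectorOptimization.

Unset Implicit Arguments.

Theorem theorem5p1 (R : realType) (X Y Z : tvsType R)
    (hX : hausdorff_space X) (hY : hausdorff_space Y) (hZ : hausdorff_space Z)
    (K : set Y) (K_closed : closed K) (K_pointed : pointed_cone K)
    (K_convex_set : convex_set K) (K_cone : is_cone K) (K_int : K° !=set0)
    (S : set Z) (S_nonempty : S !=set0) (S_closed : closed S)
    (S_convex_set : convex_set S) (S_cone : is_cone S)
    (C : set X) (C_nonempty : C !=set0) (C_closed : closed C)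
    (C_convex : convex_set C)
    (F : X -> \bar Y) (F_proper : proper_mapping F) (F_convex : K_convex K F)
    (F_lsc : forall ystar : top_dual Y,
       lower_semicontinuous (fun x => er_map ystar (F x) : \bar R))
    (G : X -> \bar Z) (G_proper : proper_mapping G) (G_convex : K_convex S G)
    (G_epi_closed : K_epi_closed S G)
    (xbar : X) (xbar_feasible : feasible_set C S G xbar) (xbar_dom : dom_ext F xbar) :
  let e :=
    closed_regarding
      (\bigcup_(T in Lplus S K) epiK_conj K (lagrangian C F G T))
      [set (contLinear0 X Y, - fine (F xbar))] in
  let f :=
    weak_solution K S C F G xbar <->
    exists2 T, Lplus S K T &
      addset (conj_map K (lagrangian C F G T) (contLinear0 X Y)) K (- F xbar)%E in
  let g :=
    weak_solution K S C F G xbar <->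
    exists2 T, Lplus S K T &
      forall x, C x ->
        ~ (EFin @` oppset K°) (F x + er_map T (G x) - F xbar)%E in
  (e <-> f) /\ (f <-> g).
Proof.
move=> e f g.
pose P := \bigcup_(T in Lplus S K) epiK_conj K (lagrangian C F G T).
pose dualF := exists2 T, Lplus S K T &
    addset (conj_map K (lagrangian C F G T) (contLinear0 X Y)) K (- F xbar)%E.
have [yb Fxb] : exists yb, F xbar = yb%:E.
  case Fx: (F xbar) => [y| |]; first by exists y.
    by exfalso; exact: xbar_dom.
  by exfalso; apply: F_proper.2; exists xbar.
have conjP := lagrangian_conjP K_convex_set K_cone K_int F_proper G_proper
  xbar_feasible Fxb.
have wsP : weak_solution K S C F G xbar <->
    closure P (contLinear0 X Y, - yb).
  split; first exact: closure_epi_union_weak_solution.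
  exact: weak_solution_closure_epi_union.
have eP : e <-> (weak_solution K S C F G xbar -> dualF).
  rewrite /e /closed_regarding -/P /dualF Fxb /=; split.
    move=> eqP /wsP clq.
    have : ([set (contLinear0 X Y, - yb)] `&` closure P)
      (contLinear0 X Y, - yb) by split.
    by rewrite eqP => -[_ [T TS HT]]; exists T.
  move=> wsT; apply/seteqP; split=> [_ [-> /= /wsP/wsT[T TS HT]]|q [qe Pq]].
    by split => //; exists T.
  by split => //; exact: subset_closure.
have dual_ws : dualF -> weak_solution K S C F G xbar.
  rewrite /dualF Fxb => -[T TS HT]; apply/wsP/subset_closure.
  by exists T.
have fP : f <-> (weak_solution K S C F G xbar -> dualF).
  by rewrite /f; split => [[]//|h]; split.
split; first by rewrite eP fP.
rewrite /f /g -/dualF (_ : dualF = (exists2 T, Lplus S K T &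
   forall x, C x -> ~ (EFin @` oppset K°) (F x + er_map T (G x) - F xbar)%E))//.
apply/propext; split=> -[T TS HT]; exists T => //; move: HT; rewrite Fxb.
  move=> /conjP noK x Cx [_ [k Kk <-]].
  case Fx: (F x) => [u| |] //; case Gx: (G x) => [z| |] // [kE].
  apply: (noK _ _ _ Cx Fx Gx); rewrite /= sub0r.
  by rewrite opprK addrC -opprB -kE opprK.
move=> noK; apply/conjP => x u z Cx Fx Gx Ku; apply: (noK x Cx).
rewrite Fx Gx /=; exists (u + T z - yb) => //.
exists (- (u + T z) + yb); last by rewrite opprD opprK.
by move: Ku; rewrite /= sub0r opprK.
Qed.
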